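(* Let $Z$ be a real random variable whose distribution is symmetric about $0$, with mean $0$ and variance $1$. For every $v > 0$, with $w=\max\{v,1\}$, the inequality $$P(Z\geq v)\leq \frac{1}{2w^2}$$ holds, with equality if $Z$ takes the values $-w$, $0$, $w$ with probabilities $\frac{1}{2w^2}$, $1-\frac{1}{w^2}$, $\frac{1}{2w^2}$, respectively.
   Context: A random variable $Z$ is symmetric (about $0$) if $Z$ and $-Z$ have the same distribution. *)

(* Defs.v *)
From mathcomp Require Import all_boot all_order all_algebra.
From mathcomp Require Import all_classical all_reals all_analysis.
From mathcomp Require Import measurable_realfun.

Set Implicit Arguments.
Unset Strict Implicit.
Unset Printing Implicit Defensive.

(* Laws are compared on measurable sets only: as a function on all of
   [set R], a measure has unspecified values off its sigma-algebra. *)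
Definition symmetric_RV (d : measure_display) (T : measurableType d)
    (R : realType) (P : probability T R) (Z : {RV P >-> R}) : Prop :=
  forall A : set R, measurable A ->
    distribution P Z A = distribution P (- Z : {RV P >-> R})%R A.

(* Main.v *)
Require Import Defs.
From mathcomp Require Import all_boot all_order all_algebra.
From mathcomp Require Import all_classical all_reals all_analysis.
From mathcomp Require Import measurable_realfun.

(** Symmetry turns a two-sided tail bound into a one-sided bound with half the
constant: for [v > 0] the events [Z >= v] and [Z <= -v] are disjoint, equally
likely, and together make up [|Z| >= v]. Chebyshev's inequality with mean [0]
and variance [1] gives [P(|Z| >= v) <= 1/v^2], which is informative only for
[v >= 1]; for smaller [v] the trivial bound [1] is better, and the smaller of
the two is [1/w^2] with [w = max v 1].

In the extremal case equality follows from the inequality itself: as [w >= v],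
the atom at [w] already contributes [1/(2 w^2)] to the tail [Z >= v], and the
inequality forbids more. *)

Import Order.TTheory GRing.Theory Num.Theory.
Local Open Scope classical_set_scope.
Local Open Scope ring_scope.

Lemma abs_tailE (T : Type) (R : realDomainType) (f : T -> R) (v : R) :
  [set t | v <= `|f t|] = [set t | v <= f t] `|` [set t | v <= - f t].
Proof. by apply/seteqP; split=> t /=; rewrite ler_normr => /orP. Qed.

Lemma measurable_RV_ge (d : measure_display) (T : measurableType d)
    (R : realType) (P : probability T R) (X : {RV P >-> R}) (v : R) :
  measurable [set t | v <= X t].
Proof. by rewrite -preimage_itvcy; exact: measurable_funPTI. Qed.

Lemma symmetric_RV_tails (d : measure_display) (T : measurableType d)
    (R : realType) (P : probability T R) (Z : {RV P >-> R}) (v : R) :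
  symmetric_RV Z -> P [set t | v <= Z t] = P [set t | v <= - Z t].
Proof.
move=> /(_ `[v, +oo[%classic (measurable_itv _)).
by rewrite /distribution /pushforward /= !preimage_itvcy.
Qed.

(** For [v > 0] the two one-sided tails are disjoint, so their equal
probabilities add up to that of the two-sided tail. *)
Lemma symmetric_RV_abs_tail (d : measure_display) (T : measurableType d)
    (R : realType) (P : probability T R) (Z : {RV P >-> R}) (v : R) :
  symmetric_RV Z -> 0 < v ->
  P [set t | v <= `|Z t|] = (2%:E * P [set t | (v <= Z t)%R])%E.
Proof.
move=> symZ v_gt0.
rewrite abs_tailE measureU.
- by rewrite -[X in _ + X]symmetric_RV_tails// -mule2n mule_natl.
- exact: measurable_RV_ge.
- exact: (measurable_RV_ge _ _ _ P (- Z : {RV P >-> R})).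
- rewrite -subset0 => t /= [vZ vNZ].
  have := lt_le_trans v_gt0 vZ.
  by rewrite ltNge -oppr_ge0 (le_trans (ltW v_gt0) vNZ).
Qed.

(** For [v <= 1] the right-hand side is [1], the total mass; for [v > 1] it is
Chebyshev's bound. *)
Lemma chebyshev_standardized (d : measure_display) (T : measurableType d)
    (R : realType) (P : probability T R) (Z : {RV P >-> R}) (v : R) :
  ('E_P[Z] = 0)%E -> ('V_P[Z] = 1)%E -> 0 < v ->
  (P [set t | (v <= `|Z t|)%R] <= ((Num.max v 1) ^- 2)%:E)%E.
Proof.
move=> meanZ varZ v_gt0; case: (leP v 1) => [_|_].
  rewrite expr1n invr1; apply: probability_le1; rewrite abs_tailE.
  apply: measurableU; first exact: measurable_RV_ge.
  exact: (measurable_RV_ge _ _ _ P (- Z : {RV P >-> R})).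
have := chebyshev Z v_gt0; rewrite varZ mule1 meanZ.
by under eq_set do rewrite subr0.
Qed.

Lemma symmetric_RV_tail_le (d : measure_display) (T : measurableType d)
    (R : realType) (P : probability T R) (Z : {RV P >-> R}) (v : R) :
  symmetric_RV Z -> ('E_P[Z] = 0)%E -> ('V_P[Z] = 1)%E -> 0 < v ->
  (P [set t | (v <= Z t)%R] <= (1 / (2 * (Num.max v 1) ^+ 2))%:E)%E.
Proof.
move=> symZ meanZ varZ v_gt0.
have := chebyshev_standardized _ _ _ P Z v meanZ varZ v_gt0.
rewrite symmetric_RV_abs_tail// -lee_pdivlMl//.
by rewrite -EFinM div1r (invfM 2).
Qed.

Theorem theorem3p1 (d : measure_display) (T : measurableType d) (R : realType)
    (P : probability T R) (Z : {RV P >-> R}) (symZ : symmetric_RV Z)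
    (meanZ : ('E_P[Z] = 0)%E) (varZ : 'V_P[Z] = 1%E) (v : R) (v_gt0 : 0 < v) :
  let w := Num.max v 1 in
  (P [set t | (v <= Z t)%R] <= (1 / (2 * w ^+ 2))%:E)%E /\
  (P [set t | Z t = - w] = (1 / (2 * w ^+ 2))%:E ->
   P [set t | Z t = 0] = (1 - 1 / w ^+ 2)%:E ->
   P [set t | Z t = w] = (1 / (2 * w ^+ 2))%:E ->
   P [set t | v <= Z t] = (1 / (2 * w ^+ 2))%:E).
Proof.
move=> w.
have tail_le : (P [set t | (v <= Z t)%R] <= (1 / (2 * w ^+ 2))%:E)%E.
  exact: symmetric_RV_tail_le.
split=> // _ _ atom_w.
apply/eqP; rewrite eq_le tail_le -atom_w.
apply: le_measure; rewrite ?inE.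
- have -> : [set t | Z t = w] = Z @^-1` [set w] by [].
  exact: measurable_funPTI.
- exact: measurable_RV_ge.
- by move=> t /= ->; rewrite le_max lexx.
Qed.
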